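(* Let $\mathcal{A}=\{a_1,\ldots,a_n\}\subset\{(r,s,t)\in(\mathbb{Z}_{\ge 0})^3 : r+s+t=d\}$ be a set of $n$ distinct points with $\operatorname{conv}(\mathcal{A})$ two-dimensional, and let $L\subset\mathbb{TP}^{n-1}$ be a tropical line, regarded as a linear pencil of tropical plane curves with support set $\mathcal{A}$. Then a point $P\in\mathbb{TP}^2$ belongs to the fixed locus of $L$ if and only if there exists a point $c=(c_1,\ldots,c_n)\in L$ such that one of the following two cases holds: (1) there exist elements $i,j,k,\ell\in\{1,\ldots,n\}$ with $i\ne j$ and $k\neq \ell$ such that the pairs of leaves $\{i,j\}$ and $\{k,\ell\}$ belong to different components of $L\setminus\{c\}$ (that is, the leaves $i,j$ lie in one component, and the leaves $k,\ell$ lie in another one), and the minimum of $\{c_m+a_m\cdot P\}_{m=1,\ldots,n}$ is attained by the terms with indices $i,j,k,\ell$ (and possibly by further terms); (2) there exist elements $i,j,k\in\{1,\ldots,n\}$ such that the leaves $i,j,k$ belong to three different components of $L\setminus\{c\}$ (thus $c$ is a vertex of $L$), and the minimum of $\{c_m+a_m\cdot P\}_{m=1,\ldots,n}$ is attained by the terms with indices $i,j,k$ (and possibly by further terms).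
   Context: $\mathbb{TP}^{m}=\mathbb{R}^{m+1}/\mathbb{R}(1,\ldots,1)$. Here $d$ is a fixed integer, $a_i=(r_i,s_i,t_i)$, $n\geq 3$, and for $P=(x,y,z)$ we write $a_i\cdot P=r_ix+s_iy+t_iz$. Changing the representative of $P\in\mathbb{TP}^2$ or of $c\in\mathbb{TP}^{n-1}$ adds the same constant to all numbers $c_i+a_i\cdot P$. For $c\in\mathbb{TP}^{n-1}$, the tropical plane curve with support $\mathcal{A}$ and coefficient vector $c$ is $\mathcal{T}(F_c)=\{P\in\mathbb{TP}^2 : \min_{i}\{c_i+a_i\cdot P\}$ is attained by at least two indices $i\}$. A tropical line $L\subset\mathbb{TP}^{n-1}$ is a closed embedded metric tree with exactly $n$ unbounded edges (rays), labelled $1,\ldots,n$, all of whose vertices have valence at least $3$, satisfying the following: if an edge of $L$ splits the label set into $I$ and $I^c=\{1,\ldots,n\}\setminus I$, then the direction of this edge, towards the side of $I$, is $e_I=\sum_{i\in I}e_i$ (in particular, the ray labelled $i$ has direction $e_i$). The leaf $i$ is the point at infinity of the ray labelled $i$. A leaf is said to lie in a component of $L\setminus\{c\}$ if (the far part of) the corresponding ray lies in it. The linear pencil $L$ is the family of curves $\mathcal{T}(F_c)$, $c\in L$. The fixed locus of $L$ is the set of points $P\in\mathbb{TP}^2$ such that $P\in\mathcal{T}(F_c)$ for every $c\in L$. *)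

(* Defs.v *)
From HB Require Import structures.
From mathcomp Require Import all_boot all_order all_algebra.
From mathcomp Require Import all_classical all_reals all_analysis.
From mathcomp Require Import ring lra.
Import Order.TTheory GRing.Theory Num.Theory.
Import numFieldNormedType.Exports.

Set Implicit Arguments.
Unset Strict Implicit.
Unset Printing Implicit Defensive.

Local Open Scope classical_set_scope.
Local Open Scope ring_scope.
Local Open Scope quotient_scope.

Definition proj_rel (R : realType) (n : nat) : rel 'rV[R]_n :=
  fun u v => `[< exists t : R, v = u + const_mx t >].

Lemma proj_rel_equiv (R : realType) (n : nat) : equiv_class_of (@proj_rel R n).
Proof.
split=> [u|u v|v u w].
- by apply/asboolP; exists 0; rewrite raddf0 addr0.
- by apply/asboolP/asboolP=> -[t ->]; exists (- t); rewrite raddfN addrK.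
- move=> /asboolP[s ->] /asboolP[t ->]; apply/asboolP; exists (s + t).
  by rewrite raddfD addrA.
Qed.

Canonical proj_equiv (R : realType) (n : nat) : equiv_rel 'rV[R]_n :=
  EquivRelPack (@proj_rel_equiv R n).

(* R^n / R(1,...,1) with the quotient topology.  The index is the number of
   homogeneous coordinates: [TP R n] is the tropical projective space of
   dimension n - 1. *)
Definition TP (R : realType) (n : nat) : topologicalType :=
  quotient_topology {eq_quot (@proj_equiv R n)}.

Definition tpi (R : realType) (n : nat) (u : 'rV[R]_n) : TP R n :=
  \pi_(quotient_topology {eq_quot (@proj_equiv R n)}) u.

Definition trepr (R : realType) (n : nat) (x : TP R n) : 'rV[R]_n :=
  repr (x : quotient_topology {eq_quot (@proj_equiv R n)}).

Lemma treprK (R : realType) (n : nat) : cancel (@trepr R n) (@tpi R n).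
Proof. by move=> x; rewrite /tpi /trepr reprK. Qed.

Lemma tpi_eq (R : realType) (n : nat) (u v : 'rV[R]_n) :
  tpi u = tpi v <-> exists t : R, v = u + const_mx t.
Proof.
split=> [/(@eqmodP _ (proj_equiv R n))/asboolP //|uv].
by apply/(@eqmodP _ (proj_equiv R n))/asboolP.
Qed.

Lemma trepr_pi (R : realType) (n : nat) (u : 'rV[R]_n) :
  exists t : R, trepr (tpi u) = u + const_mx t.
Proof. by apply/tpi_eq; rewrite treprK. Qed.

(* The vector e_I, the sum of the e_i over i in I. *)
Definition indic_row (R : realType) (n : nat) (I : {set 'I_n}) : 'rV[R]_n :=
  \row_i (i \in I)%:R.

(* The point x + t e_I. *)
Definition tmove (R : realType) (n : nat) (x : TP R n) (t : R)
    (I : {set 'I_n}) : TP R n :=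
  tpi (trepr x + t *: indic_row R I).

Lemma tmove_pi (R : realType) (n : nat) (u : 'rV[R]_n) (t : R)
    (I : {set 'I_n}) : tmove (tpi u) t I = tpi (u + t *: indic_row R I).
Proof.
have [s us] := trepr_pi u; apply/tpi_eq; exists (- s).
by rewrite us raddfN addrAC addrK.
Qed.

Definition conv_hull (R : realType) (n m : nat) (p : 'I_n -> 'rV[R]_m) :
    set 'rV[R]_m :=
  [set x | exists w : 'I_n -> R,
    [/\ forall i, 0 <= w i, \sum_i w i = 1 & x = \sum_i w i *: p i]].

(* The affine hull of S has dimension k: k is the dimension of the smallest
   linear subspace U (given as a row space) containing all differences. *)
Definition has_dim (R : realType) (m : nat) (S : set 'rV[R]_m) (k : nat) :
    Prop :=
  exists2 U : 'M[R]_m, \rank U = k &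
    forall V : 'M[R]_m,
      (U <= V)%MS <-> (forall x y, S x -> S y -> (x - y <= V)%MS).

(* c_m + a_m . P, computed on representatives of c and P. *)
Definition trop_term (R : realType) (n : nat) (a : 'I_n -> 'rV[int]_3)
    (c : TP R n) (P : TP R 3) (m : 'I_n) : R :=
  trepr c 0 m + \sum_k (a m 0 k)%:~R * trepr P 0 k.

Definition attains_min (R : realType) (n : nat) (a : 'I_n -> 'rV[int]_3)
    (c : TP R n) (P : TP R 3) (i : 'I_n) : Prop :=
  forall m : 'I_n, trop_term a c P i <= trop_term a c P m.

Lemma attains_min_pi (R : realType) (n : nat) (d : int)
    (a : 'I_n -> 'rV[int]_3) (u : 'rV[R]_n) (v : 'rV[R]_3) (i : 'I_n) :
  (forall m, \sum_k a m 0 k = d) ->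
  attains_min a (tpi u) (tpi v) i <->
  (forall m, u 0 i + \sum_k (a i 0 k)%:~R * v 0 k
          <= u 0 m + \sum_k (a m 0 k)%:~R * v 0 k).
Proof.
move=> ad; have [s us] := trepr_pi u; have [t vt] := trepr_pi v.
have tE m : trop_term a (tpi u) (tpi v) m =
    u 0 m + \sum_k (a m 0 k)%:~R * v 0 k + (s + d%:~R * t).
  rewrite /trop_term us vt !mxE.
  under eq_bigr do rewrite mxE mxE mulrDr.
  rewrite big_split /= -mulr_suml -(rmorph_sum intr) ad; ring.
by split=> H m; move: (H m); rewrite !tE lerD2r.
Qed.

Definition trop_curve (R : realType) (n : nat) (a : 'I_n -> 'rV[int]_3)
    (c : TP R n) : set (TP R 3) :=
  [set P | exists i j : 'I_n,
    [/\ i != j, attains_min a c P i & attains_min a c P j]].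

Definition fixed_locus (R : realType) (n : nat) (a : 'I_n -> 'rV[int]_3)
    (L : set (TP R n)) : set (TP R 3) :=
  [set P | forall c, L c -> trop_curve a c P].

(* The data of a metric tree with n labelled rays and vertices mapped to
   [TP R n]: [tadj] is the adjacency relation of the bounded edges, and the
   i-th ray is attached to the vertex [tray i]. *)
Record tree_data (R : realType) (n : nat) := TreeData {
  tvertex : finType;
  tadj : rel tvertex;
  tlen : tvertex -> tvertex -> R;
  tray : 'I_n -> tvertex;
  tpos : tvertex -> TP R n
}.

Section Trees.
Variables (R : realType) (n : nat) (T : tree_data R n).
Implicit Types (u v w : tvertex T) (i j : 'I_n).

(* The labels on the side of v after deletion of the edge uv. *)
Definition tside u v : {set 'I_n} :=
  [set i | connect
    [rel x y | tadj x y && ([set x; y] != [set u; v])%SET] v (tray T i)]%SET.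

Definition tedge u v : set (TP R n) :=
  [set tmove (tpos u) t (tside u v) | t in [set t : R | 0 <= t <= tlen u v]].

Definition traypts i : set (TP R n) :=
  [set tmove (tpos (tray T i)) t [set i]%SET | t in [set t : R | 0 <= t]].

Definition tsupport : set (TP R n) :=
  [set x | (exists u v, tadj u v /\ tedge u v x) \/ (exists i, traypts i x)].

Definition combinatorial_tree : Prop :=
  [/\ symmetric (@tadj _ _ T), irreflexive (@tadj _ _ T),
      forall u v, connect (@tadj _ _ T) u v
    & forall p : seq (tvertex T), ucycle (@tadj _ _ T) p -> (size p <= 2)%N].

Definition valence v : nat :=
  (#|[set w | tadj v w]%SET| + #|[set i | tray T i == v]%SET|)%N.

Definition edge_directions : Prop :=
  forall u v, tadj u v ->
    [/\ 0 < tlen u v, tlen v u = tlen u v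
      & tpos v = tmove (tpos u) (tlen u v) (tside u v)].

(* Distinct edges or rays meet only in the images of common vertices. *)
Definition embedded_tree : Prop :=
  [/\ injective (@tpos _ _ T),
      forall u v u' v', tadj u v -> tadj u' v' ->
        ([set u; v] != [set u'; v'])%SET ->
        tedge u v `&` tedge u' v' `<=`
          [set tpos w | w in [set w | (w \in [set u; v] :&: [set u'; v'])%SET]],
      forall u v i, tadj u v ->
        tedge u v `&` traypts i `<=`
          [set tpos w | w in [set w | (w \in [set u; v])%SET /\ w = tray T i]]
    & forall i j, i != j ->
        traypts i `&` traypts j `<=`
          [set tpos w | w in [set w | w = tray T i /\ w = tray T j]]].

Definition tropical_line : Prop :=
  [/\ combinatorial_tree, forall v, (3 <= valence v)%N, edge_directions,
      embedded_tree & closed tsupport].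

(* The far part of the i-th ray lies in C. *)
Definition leaf_in i (C : set (TP R n)) : Prop :=
  exists t0 : R, forall t : R, t0 <= t ->
    C (tmove (tpos (tray T i)) t [set i]%SET).

End Trees.

Definition component_of (X : topologicalType) (A C : set X) : Prop :=
  exists2 x, A x & C = connected_component A x.

(* Main.v *)
Require Import Defs.
From mathcomp Require Import all_boot all_order all_algebra.
From mathcomp Require Import all_classical all_reals all_analysis.
From mathcomp Require Import lra.
Import Order.TTheory GRing.Theory Num.Theory.
Import numFieldNormedType.Exports.
Local Open Scope classical_set_scope.
Local Open Scope ring_scope.

(* Let x_i - x_m denote the coordinate differences of a point x of the line.
   From any x one can walk towards the leaf i, and along this walk no
   difference x_i - x_m decreases.  Hence, if c_i - c_m < x_i - x_m for some m,
   the walk avoids c, and x lies in the component of the leaf i in the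
   complement of c.  Outside this component the coordinate i is, relative to c,
   as small as possible, so a term i minimal at c remains minimal there; this
   yields one implication, as a point lies in at most one component.

   Conversely, let P be in the fixed locus.  If the minimal indices at a vertex
   or an inner edge point c meet two branches I and J, then either a third one
   is met, or each of the two contains two minimal indices: if i were the only
   one in I, it would be the only minimal index after a move into J.
   Such a point c is found at a vertex minimizing the sum over m of
   (term m - minimal term), or on an edge at this vertex. *)

(** * Coordinate differences and moves along the vectors e_I *)

Section CoordinateDifferences.
Set Implicit Arguments.
Unset Strict Implicit.
Context {R : realType} {n : nat}.
Implicit Types (x y z c : TP R n) (i j k m : 'I_n) (I J : {set 'I_n}).

(** Differences do not depend on the chosen representative, so they are genuine functions on
    [TP R n]; together they determine the point. *)
Definition dif x i m : R := trepr x 0 i - trepr x 0 m.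

Lemma dif_pi (u : 'rV[R]_n) i m : dif (tpi u) i m = u 0 i - u 0 m.
Proof. by rewrite /dif; have [t ->] := trepr_pi u; rewrite !mxE; lra. Qed.

Lemma difC x i m : dif x m i = - dif x i m.
Proof. by rewrite /dif opprB. Qed.

Lemma dif_inj x y : (forall i m, dif x i m = dif y i m) -> x = y.
Proof.
move=> xy; rewrite -(treprK x) -(treprK y); apply/tpi_eq.
case: (pselect (exists i : 'I_n, True)) => [[i _]|no].
  exists (trepr y 0 i - trepr x 0 i); apply/rowP => m; rewrite !mxE.
  by have := xy m i; rewrite /dif; lra.
(* Without any index all row vectors agree, so every shift works. *)
by exists 0; apply/rowP => m; case: no; exists m.
Qed.

Lemma dif_tmove x t I i m :
  dif (tmove x t I) i m = dif x i m + t * ((i \in I)%:R - (m \in I)%:R).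
Proof. by rewrite dif_pi !mxE /dif; lra. Qed.

Lemma dif_continuous i m : continuous (fun x => dif x i m).
Proof.
apply/quotient_continuous.
have -> : (fun x => dif x i m) \o @tpi R n =
    (fun u : 'rV[R]_n => u 0 i - u 0 m).
  by apply/funext => u /=; rewrite -dif_pi.
by move=> u; apply: continuousB; exact: coord_continuous.
Qed.

Lemma tmove_continuous x I : continuous (fun t => tmove x t I).
Proof.
move=> t; rewrite /tmove.
apply: (@continuous_comp _ _ _ (fun t : R => trepr x + t *: indic_row R I)
  (@tpi R n)); last exact: pi_continuous.
apply: continuousD; first exact: cst_continuous.
by apply: continuousZr_tmp; exact: cvg_id.
Qed.

Lemma connected_tmove x I (A : set R) :
  is_interval A -> connected [set tmove x t I | t in A].
Proof.
move=> /connected_intervalP Ac; apply: connected_continuous_connected => //.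
by apply: continuous_subspaceT; exact: tmove_continuous.
Qed.

Lemma tmoveD x s t I : tmove (tmove x s I) t I = tmove x (s + t) I.
Proof. by apply: dif_inj => i m; rewrite !dif_tmove; lra. Qed.

Lemma tmove0 x I : tmove x 0 I = x.
Proof. by apply: dif_inj => i m; rewrite !dif_tmove; lra. Qed.

(** The vector e_I + e_J for J the complement of [I] is (1,...,1), hence zero in the quotient:
    moving along one undoes moving along the other. *)
Lemma tmoveK x t I : tmove (tmove x t I) t (~: I)%SET = x.
Proof.
apply: dif_inj => i m; rewrite !dif_tmove !inE.
by case: (i \in I); case: (m \in I) => /=; lra.
Qed.

Lemma tmoveC_sub x s t I :
  tmove (tmove x t I) (t - s) (~: I)%SET = tmove x s I.
Proof.
apply: dif_inj => i m; rewrite !dif_tmove !inE.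
by case: (i \in I); case: (m \in I) => /=; lra.
Qed.

(* [x] is obtained from [y] by adding a vector that is nonnegative on [I] and
   zero elsewhere (modulo constants). *)
Definition raised I y x : Prop :=
  (forall i m, i \in I -> m \notin I -> dif y i m <= dif x i m) /\
  (forall i m, i \notin I -> m \notin I -> dif x i m = dif y i m).

Definition strictly_raised I y x : Prop :=
  (forall i m, i \in I -> m \notin I -> dif y i m < dif x i m) /\
  (forall i m, i \notin I -> m \notin I -> dif x i m = dif y i m).

Lemma raised_refl I x : raised I x x.
Proof. by []. Qed.

Lemma raised_tmove I J y x t :
  raised I y x -> J \subset I -> 0 <= t -> raised I y (tmove x t J).
Proof.
move=> [yx1 yx2] JI t0; split=> i m iI mI; rewrite dif_tmove.
  have /negbTE -> : m \notin J by apply: contra mI; exact: (fintype.subsetP JI).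
  apply: (le_trans (yx1 i m iI mI)).
  by case: (i \in J) => /=; lra.
have /negbTE -> : m \notin J by apply: contra mI; exact: (fintype.subsetP JI).
have /negbTE -> : i \notin J by apply: contra iI; exact: (fintype.subsetP JI).
by rewrite yx2 //; lra.
Qed.

(** The initial move of positive length already makes all differences between [I] and its complement
    strict, and raising further cannot lose this. *)
Lemma strictly_raised_tmove I c x t :
  0 < t -> raised I (tmove c t I) x -> strictly_raised I c x.
Proof.
move=> t0 [yx1 yx2]; split=> i m iI mI.
  by have := yx1 i m iI mI; rewrite dif_tmove iI (negbTE mI) /=; lra.
by rewrite yx2 // dif_tmove (negbTE iI) (negbTE mI); lra.
Qed.

End CoordinateDifferences.

(* [F] is the family of the label sets of the branches of [L] at [c]. *)
Definition branching {R : realType} {n : nat} (L : set (TP R n)) (c : TP R n)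
    (F : {set 'I_n} -> Prop) : Prop :=
  [/\ forall i, exists I, F I /\ i \in I,
      forall I J i, F I -> F J -> i \in I -> i \in J -> I = J,
      forall I, F I -> I != finset.set0,
      forall I, F I -> exists t, 0 < t /\ L (tmove c t I)
    & forall x, L x -> x <> c -> exists I, F I /\ strictly_raised I c x].

(** * Edges of the tree and the label splits they induce *)

Section TropicalTree.
Set Implicit Arguments.
Unset Strict Implicit.
Context {R : realType} {n : nat} {T : tree_data R n}.
Context (Tcomb : combinatorial_tree T) (Tdir : edge_directions T).
Context (Tinj : injective (@tpos _ _ T)).
Implicit Types (u v w a b : tvertex T) (i j k m : 'I_n) (x y c : TP R n).

Local Notation del u v :=
  [rel x y | tadj x y && ([set x; y] != [set u; v])%SET].

Lemma tadjC u v : tadj u v = tadj v u.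
Proof. by case: Tcomb. Qed.

Lemma delC u v : del u v =2 del v u.
Proof. by move=> x y /=; rewrite (finset.setUC [set u]%SET). Qed.

Lemma del_sym u v : connect_sym (del u v).
Proof.
by apply: sym_connect_sym => x y /=; rewrite tadjC (finset.setUC [set x]%SET).
Qed.

(* Otherwise a path from [v] to [u] avoiding the edge closes to a cycle. *)
Lemma bridge u v : tadj u v -> ~~ connect (del u v) v u.
Proof.
move=> uv; apply/negP => /connectP[p pp].
case/shortenP: pp => q pq uq _ {p} ulast.
have [_ irr _ cyc] := Tcomb.
have : ucycle (@tadj _ _ T) (v :: q).
  rewrite /ucycle uq andbT /= rcons_path -ulast uv andbT.
  by apply: sub_path pq => ? ? /andP[].
(* Cycles have length at most two, so the path is either trivial, giving a loop at [u], or it is the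
   deleted edge itself. *)
case: q pq uq ulast => [|w [|? ?]] pq uq ulast /cyc //.
  by move: uv; rewrite /= in ulast; rewrite ulast irr.
by rewrite /= in ulast; move: pq; rewrite /= -ulast finset.setUC eqxx !andbF.
Qed.

(** Along a path from [u] to [w], a step either survives the deletion or is the edge itself and
    lands at [u] or [v]. *)
Lemma del_cover u v w : connect (del u v) u w || connect (del u v) v w.
Proof.
have [_ _ conn _] := Tcomb; have /connectP[p pp ->] := conn u w.
elim/last_ind: p pp => [|p b IH]; first by rewrite connect0.
rewrite rcons_path last_rcons => /andP[/IH {}IH].
set a := last u p in IH * => ab.
case: (boolP ([set a; b] == [set u; v])%SET) => [/eqP e|ne].
  have : b \in [set u; v]%SET by rewrite -e !inE eqxx orbT.
  by rewrite !inE => /orP[] /eqP ->; rewrite connect0 ?orbT.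
have ab' : connect (del u v) a b by apply: connect1; rewrite /= ab ne.
by case/orP: IH => /connect_trans /(_ ab') ->; rewrite ?orbT.
Qed.

(** The two sides cover all labels by [del_cover] and are disjoint by [bridge]. *)
Lemma tsideC u v : tadj u v -> tside v u = (~: tside u v)%SET.
Proof.
move=> uv; apply/setP => i; rewrite !inE (eq_connect (delC v u)).
have := del_cover u v (tray T i); have := bridge uv.
case: (boolP (connect (del u v) v (tray T i))) => [vi|_ _]; last by rewrite orbF.
move=> br _; apply/negbTE; apply: contra br => ui.
by apply: (connect_trans vi); rewrite del_sym.
Qed.

Lemma tedgeC u v : tadj u v -> tedge u v = tedge v u.
Proof.
have sub : forall u v, tadj u v -> tedge u v `<=` tedge v u.
  move=> {}u {}v uv _ [t /= /andP[t0 tl] <-]; have [_ l e] := Tdir uv.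
  exists (tlen u v - t); first by rewrite /= l subr_ge0 tl; lra.
  by rewrite e (tsideC uv) tmoveC_sub.
by move=> uv; apply/seteqP; split; apply: sub => //; rewrite tadjC.
Qed.

(** Otherwise the edge vector would be a multiple of (1,...,1), and both end points would have the
    same position, against injectivity. *)
Lemma tside_neqT u v : tadj u v -> tside u v != [set: 'I_n]%SET.
Proof.
move=> uv; apply/negP => /eqP e.
have euv : u = v.
  apply: Tinj; have [_ _ ->] := Tdir uv.
  by apply: dif_inj => i m; rewrite dif_tmove e !inE; lra.
by move: uv; rewrite euv; have [_ -> _ _] := Tcomb.
Qed.

Lemma tside_neq0 u v : tadj u v -> tside u v != finset.set0.
Proof.
move=> uv; apply: contra (tside_neqT (etrans (tadjC v u) uv)) => /eqP e.
by rewrite tsideC // e finset.setC0.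
Qed.

(** A path from [w] avoiding the edge [vw] never meets [v], by [bridge]; hence it avoids the edge
    [uv] too. *)
Lemma tside_subset u v w : tadj u v -> tadj v w -> w != u ->
  tside v w \subset tside u v.
Proof.
move=> uv vw wu; apply/fintype.subsetP => i; rewrite !inE => wi.
have vw' : connect (del u v) v w.
  apply: connect1; rewrite /= vw /=; apply/negP => /eqP e.
  have : w \in [set u; v]%SET by rewrite -e !inE eqxx orbT.
  rewrite !inE (negbTE wu) /= => /eqP wv; move: vw; rewrite wv.
  by have [_ -> _ _] := Tcomb.
apply: (connect_trans vw'); move: wi => /connectP[p pp ->].
elim/last_ind: p pp => [|p b IH]; first by rewrite connect0.
rewrite rcons_path last_rcons => /andP[pp /andP[ab ne]].
apply: (connect_trans (IH pp)); apply: connect1; rewrite /= ab /=.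
have wa : connect (del v w) w (last w p) by apply/connectP; exists p.
have wb : connect (del v w) w b.
  by apply: (connect_trans wa); apply: connect1; rewrite /= ab ne.
apply/negP => /eqP e.
have : v \in [set last w p; b]%SET by rewrite e !inE eqxx orbT.
by rewrite !inE => /orP[]/eqP ev; move: (bridge vw);
  rewrite {2}ev ?wa ?wb.
Qed.

Lemma ray_tside u v i : tray T i = v -> i \in tside u v.
Proof. by move=> <-; rewrite inE connect0. Qed.

(* Non-backtracking walks whose first edge is [uv] and whose last edge is
   [ab]. *)
Inductive walk u v : tvertex T -> tvertex T -> Prop :=
| walk0 : tadj u v -> walk u v u v
| walkS a b w : walk u v a b -> tadj b w -> w != a -> walk u v b w.

Lemma walk_cons u v w a b : tadj v u -> w != v -> walk u w a b -> walk v u a b.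
Proof.
move=> vu wv; elim=> [uw|a' b' w' _ IH bw wa]; last exact: walkS IH bw wa.
by apply: walkS uw wv; exact: walk0.
Qed.

(** A path without repeated vertices does not backtrack. *)
Lemma walk_exists u b : b = u \/ exists v a, walk u v a b.
Proof.
have [_ _ conn _] := Tcomb; have /connectP[p pp ->] := conn u b.
case/shortenP: pp => q pq uq _ {p b}.
case/lastP: q pq uq => [|q b]; first by left.
rewrite last_rcons => pq uq; right.
suff [v w] : exists v, walk u v (last u q) b by exists v, (last u q).
elim/last_ind: q b pq uq => [|q a IH] b pq uq.
  by exists b; apply: walk0; move: pq => /= /andP[].
move: pq uq; rewrite rcons_path !last_rcons -rcons_cons rcons_uniq.
move=> /andP[pq ab] /andP[bq uq]; have [v w] := IH a pq uq.
exists v; apply: walkS w ab _; apply: contra bq => /eqP ->.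
by rewrite -rcons_cons mem_rcons inE mem_last orbT.
Qed.

(** The sides shrink along the walk, so every step after the first one only raises labels in
    [tside u v]. *)
Lemma walk_spec u v a b : walk u v a b ->
  [/\ tadj a b, tside a b \subset tside u v
    & raised (tside u v) (tpos v) (tpos b)].
Proof.
elim=> [uv|a' b' w _ [ab sub up] bw wa]; first by split=> //; exact: raised_refl.
have sub' := fintype.subset_trans (tside_subset ab bw wa) sub.
split=> //; have [l0 _ ->] := Tdir bw.
by apply: raised_tmove => //; exact: ltW.
Qed.

(** The closed star of [b]. Stars cover the support, so a point is located by a walk to the centre
    of a star containing it. *)
Definition tstar b : set (TP R n) :=
  [set x | (exists w, tadj b w /\ tedge b w x) \/
           (exists i, tray T i = b /\ traypts T i x)].

Lemma tsupport_star x : tsupport T x -> exists b, tstar b x.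
Proof.
move=> [[u [v [uv x_uv]]]|[i xi]]; first by exists u; left; exists v.
by exists (tray T i); right; exists i.
Qed.

(** Everything in the star lies beyond [v], except possibly on the edge back to [a]. That edge is
    [uv] itself for a one-edge walk; for a longer walk it is parametrized from [a], the end of the
    walk shortened by one step. *)
Lemma walk_star u v a b x : walk u v a b -> tstar b x ->
  tedge u v x \/ raised (tside u v) (tpos v) x.
Proof.
move=> W; have [ab sub up] := walk_spec W.
case=> [[w [bw xbw]]|[i [ib [t /= t0 <-]]]]; last first.
  right; rewrite ib; apply: raised_tmove => //.
  by rewrite finset.sub1set; apply: (fintype.subsetP sub); exact: ray_tside.
have [wa|wa] := eqVneq w a; last first.
  right; have [l0 _ _] := Tdir bw; move: xbw => [t /= /andP[t0 _] <-].
  apply: raised_tmove => //.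
  exact: fintype.subset_trans (tside_subset ab bw wa) sub.
move: xbw; rewrite wa -(tedgeC ab); case: W ab sub up {bw wa}.
  by move=> _ _ _ _; left.
move=> a' {}a {}b W' ab ba' _ _ _ [t /= /andP[t0 _] <-]; right.
have [a'a sub up] := walk_spec W'; apply: raised_tmove => //.
exact: fintype.subset_trans (tside_subset a'a ab ba') sub.
Qed.

(** A walk from [u] to the star of [x] either starts with the edge [uv] or can be prolonged
    backwards by the edge [vu]. *)
Lemma edge_location u v x : tadj u v -> tsupport T x ->
  [\/ tedge u v x, raised (tside u v) (tpos v) x
    | raised (tside v u) (tpos u) x].
Proof.
move=> uv /tsupport_star[b xb].
have vu : tadj v u by rewrite tadjC.
have near_v a : walk u v a b -> [\/ tedge u v x, raised (tside u v) (tpos v) x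
    | raised (tside v u) (tpos u) x].
  by move=> /walk_star /(_ xb) [] ?; [apply: Or31|apply: Or32].
have near_u a : walk v u a b -> [\/ tedge u v x, raised (tside u v) (tpos v) x
    | raised (tside v u) (tpos u) x].
  move=> /walk_star /(_ xb) [] H.
    by apply: Or31; rewrite (tedgeC).
  exact: Or33.
case: (walk_exists u b) => [bu|[w [a W]]].
  by apply: (near_u v); rewrite bu; exact: walk0.
have [wv|wv] := eqVneq w v; first by apply: (near_v a); rewrite -wv.
exact: near_u (walk_cons vu wv W).
Qed.

(** * Branches at a vertex and at an inner point of an edge *)

Definition vertex_branch u (I : {set 'I_n}) : Prop :=
  (exists v, tadj u v /\ I = tside u v) \/
  (exists i, tray T i = u /\ I = [set i]%SET).

Lemma walk_tadj u v a b : walk u v a b -> tadj u v.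
Proof. by elim. Qed.

(** The first edge of a walk from [u] determines the branch of a label or of a point; a ray at [u]
    is a branch with a single label. *)
Lemma vertex_branching u : branching (tsupport T) (tpos u) (vertex_branch u).
Proof.
have ray_notin v i : tadj u v -> tray T i = u -> i \notin tside u v.
  move=> uv iu; rewrite -finset.in_setC -tsideC //; exact: ray_tside.
split.
- move=> i; case: (walk_exists u (tray T i)) => [iu|[v [a W]]].
    by exists [set i]%SET; rewrite !inE; split=> //; right; exists i.
  exists (tside u v); split.
    by left; exists v; split=> //; exact: walk_tadj W.
  have [_ sub _] := walk_spec W.
  by apply: (fintype.subsetP sub); exact: ray_tside.
- move=> I J i [[v [uv ->]]|[j [ju ->]]] [[w [uw ->]]|[k [ku ->]]].
  + move=> iv iw; have [->//|vw] := eqVneq v w.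
    have vu : tadj v u by rewrite tadjC.
    (* The walk from [v] through [u] to [w] places [tside u w] inside the complement of
       [tside u v]. *)
    have := tside_subset vu uw; rewrite eq_sym => /(_ vw).
    by move=> /fintype.subsetP /(_ i iw); rewrite tsideC // inE iv.
  + by move=> + /finset.set1P ik; rewrite ik (negbTE (ray_notin _ _ uv ku)).
  + by move=> /finset.set1P ik; rewrite ik (negbTE (ray_notin _ _ uw ju)).
  + by move=> /finset.set1P <- /finset.set1P <-.
- move=> I [[v [uv ->]]|[j [ju ->]]]; first exact: tside_neq0.
  by apply/finset.set0Pn; exists j; rewrite inE.
- move=> I [[v [uv ->]]|[j [ju ->]]].
    have [l0 _ _] := Tdir uv; exists (tlen u v); split=> //.
    by left; exists u, v; split=> //; exists (tlen u v) => //=; rewrite ltW //=.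
  exists 1; split=> //; right; exists j; exists 1 => /=; first exact: ler01.
  by rewrite ju.
- have edge v x : tadj u v -> x <> tpos u ->
      tedge u v x \/ raised (tside u v) (tpos v) x ->
      exists I, vertex_branch u I /\ strictly_raised I (tpos u) x.
    move=> uv xu H; exists (tside u v); split; first by left; exists v.
    have [l0 _ e] := Tdir uv; case: H => [[t /= /andP[t0 _] xE]|].
      apply: (@strictly_raised_tmove _ _ _ _ _ t); last by rewrite xE.
      rewrite lt_neqAle t0 andbT eq_sym; apply/eqP => t0'; apply: xu.
      by rewrite -xE t0' tmove0.
    by rewrite e; exact: strictly_raised_tmove.
  move=> x /tsupport_star[b xb] xu.
  case: (walk_exists u b) => [bu|[v [a W]]]; last first.
    by apply: (edge v) => //; [exact: walk_tadj W | exact: walk_star W xb].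
  subst b; case: xb => [[w [bw xbw]]|[i [ib [t /= t0 xE]]]].
    by apply: (edge w) => //; left.
  rewrite ib in xE.
  exists [set i]%SET; split; first by right; exists i.
  apply: (@strictly_raised_tmove _ _ _ _ _ t); last by rewrite xE.
  rewrite lt_neqAle t0 andbT eq_sym; apply/eqP => t0'; apply: xu.
  by rewrite -xE t0' tmove0.
Qed.

(** A point other than [c] is on the same edge with a parameter different from [s], or beyond one of
    the end points; the part of the edge traversed from [c] has positive length and gives
    strictness. *)
Lemma edge_branching u v s : tadj u v -> 0 < s < tlen u v ->
  branching (tsupport T) (tmove (tpos u) s (tside u v))
    (fun I => I = tside u v \/ I = tside v u).
Proof.
move=> uv /andP[s0 sl]; set c := tmove _ _ _.
have vu : tadj v u by rewrite tadjC.
have [_ _ vE] := Tdir uv; have AC := tsideC uv.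
have cv : tpos v = tmove c (tlen u v - s) (tside u v).
  by rewrite /c tmoveD vE addrC subrK.
have cu : tpos u = tmove c s (tside v u) by rewrite /c AC tmoveK.
have ls0 : 0 < tlen u v - s by rewrite subr_gt0.
split.
- move=> i; case: (boolP (i \in tside u v)) => iA.
    by exists (tside u v); split=> //; left.
  by exists (tside v u); split; [right | rewrite AC finset.in_setC].
- by move=> I J i [] -> [] -> //; rewrite AC finset.in_setC; case: (i \in tside u v).
- by move=> I [] ->; exact: tside_neq0.
- move=> I [] ->.
    exists (tlen u v - s); split=> //; rewrite -cv; left; exists v, u.
    by split=> //; exists 0; rewrite ?tmove0 //= lexx /= ltW //; case: (Tdir vu).
  exists s; split=> //; rewrite -cu; left; exists u, v.
  by split=> //; exists 0; rewrite ?tmove0 //= lexx /= ltW //; case: (Tdir uv).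
- move=> x Lx xc; case: (edge_location uv Lx).
  + move=> [t /= /andP[t0 tl] xE].
    case: (ltgtP s t) => st.
    * exists (tside u v); split; first by left.
      apply: (@strictly_raised_tmove _ _ _ _ _ (t - s)); first by rewrite subr_gt0.
      by rewrite /c tmoveD addrC subrK xE.
    * exists (tside v u); split; first by right.
      apply: (@strictly_raised_tmove _ _ _ _ _ (s - t)); first by rewrite subr_gt0.
      by rewrite /c AC tmoveC_sub xE.
    * by case: xc; rewrite -xE /c st.
  + rewrite cv => H; exists (tside u v); split; first by left.
    exact: strictly_raised_tmove H.
  + rewrite {1}cu => H; exists (tside v u); split; first by right.
    exact: strictly_raised_tmove H.
Qed.

(** * Walking from a point towards a leaf *)

(** The walk is recorded as a connected set rather than as a parametrized path; it suffices to
    compare its points with the starting point [x]. *)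
Definition flows i x : Prop := exists S : set (TP R n),
  [/\ connected S, S `<=` tsupport T, S x,
      forall y, S y -> forall m, dif x i m <= dif y i m
    & exists t0, forall t, t0 <= t ->
        S (tmove (tpos (tray T i)) t [set i]%SET)].

(** Since [i] is on the side of [v], moving towards [v] lowers no difference from [i]; the segment
    is joined at [v] with the set given there. *)
Lemma flows_edge i u v t : tadj u v -> i \in tside u v -> 0 <= t <= tlen u v ->
  flows i (tpos v) -> flows i (tmove (tpos u) t (tside u v)).
Proof.
move=> uv iA /andP[t0 tl] [S [Sc SL Sv Sm Sr]].
have [l0 _ vE] := Tdir uv.
pose S1 := [set tmove (tpos u) s (tside u v) | s in `[t, tlen u v]].
have xm s m : t <= s -> dif (tmove (tpos u) t (tside u v)) i m <=
    dif (tmove (tpos u) s (tside u v)) i m.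
  move=> ts; rewrite !dif_tmove iA /=.
  by case: (m \in _) => /=; lra.
exists (S1 `|` S); split.
- apply: connectedU => //.
    exists (tpos v); split=> //; exists (tlen u v); last by rewrite -vE.
    by rewrite /= in_itv /= tl lexx.
  by apply: connected_tmove; exact: interval_is_interval.
- move=> y [[s]|/SL //]; rewrite /= in_itv /= => /andP[ts sl] <-.
  left; exists u, v; split=> //; exists s => //=.
  by rewrite sl (le_trans t0).
- by left; exists t => //=; rewrite in_itv /= lexx.
- move=> y [[s]|Sy] /= ; last first.
    by move=> m; apply: le_trans (Sm y Sy m); rewrite vE; exact: xm.
  by rewrite in_itv /= => /andP[ts sl] <- m; exact: xm.
- by have [s0 H] := Sr; exists s0 => s /H; right.
Qed.

Lemma flows_vertex i u : flows i (tpos u).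
Proof.
have [_ _ conn _] := Tcomb; have /connectP[p0 pp0 e0] := conn u (tray T i).
case/shortenP: pp0 e0 => p pp up _ {p0} ip.
elim: p u pp up ip => [|v p IH] u /=.
  move=> _ _ iu; exists (traypts T i); split.
  - suff -> : traypts T i = [set tmove (tpos (tray T i)) t [set i]%SET |
        t in `[0, +oo[].
      by apply: connected_tmove; exact: interval_is_interval.
    by apply/seteqP; split=> y [t]; rewrite /= ?in_itv /= ?andbT => t0 <-;
      exists t => //=; rewrite in_itv /= andbT.
  - by move=> y yi; right; exists i.
  - by exists 0 => /=; rewrite ?tmove0 ?iu.
  - move=> y [t /= t0 <-] m; rewrite dif_tmove iu inE eqxx.
    by case: (m \in _) => /=; lra.
  - by exists 0 => t t0; exists t.
move=> /andP[uv pp] /andP[up uvp] ip.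
have Fv := IH v pp uvp ip.
rewrite -(tmove0 (tpos u) (tside u v)); apply: flows_edge => //.
  rewrite inE ip; apply/connectP; exists p => //.
  (* A path that never meets [u] cannot use the edge [uv], so it stays on the side of [v]. *)
  have avoid q : forall a, path (@tadj _ _ T) a q -> u \notin a :: q ->
      path [rel a b | tadj a b && ([set a; b] != [set u; v])%SET] a q.
    elim: q => //= b q IHq a /andP[ab qq].
    rewrite !inE !negb_or => /and3P[ua ub uq].
    rewrite ab IHq ?inE ?negb_or ?ub //= andbT; apply/negP => /eqP e.
    have : u \in [set a; b]%SET by rewrite e !inE eqxx.
    by rewrite !inE (negbTE ua) (negbTE ub).
  exact: avoid.
by rewrite lexx ltW //; case: (Tdir uv).
Qed.

Lemma flows_support i x : tsupport T x -> flows i x.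
Proof.
move=> [[u [v [uv [t /= /andP[t0 tl] <-]]]]|[j [t /= t0 <-]]].
  have vu : tadj v u by rewrite tadjC.
  have [l0 l vE] := Tdir uv; case: (boolP (i \in tside u v)) => iA.
    by apply: flows_edge (flows_vertex i v); rewrite ?t0.
  have -> : tmove (tpos u) t (tside u v) =
      tmove (tpos v) (tlen u v - t) (tside v u).
    by rewrite vE (tsideC uv) tmoveC_sub.
  apply: flows_edge (flows_vertex i u) => //.
    by rewrite (tsideC uv) finset.in_setC.
  by rewrite l; lra.
have [<-|ji] := eqVneq j i.
  exists [set tmove (tpos (tray T j)) s [set j]%SET | s in `[t, +oo[]; split.
  - by apply: connected_tmove; exact: interval_is_interval.
  - move=> _ [s /= + <-]; rewrite in_itv /= andbT => ts.
    by right; exists j; exists s => //=; exact: le_trans ts.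
  - by exists t => //=; rewrite in_itv /= lexx.
  - move=> _ [s /= + <-] m; rewrite in_itv /= andbT => ts.
    by rewrite !dif_tmove inE eqxx; case: (m \in _) => /=; lra.
  - by exists t => s ts; exists s => //=; rewrite in_itv /= andbT.
(* From another ray [j], first descend to its vertex: only the coordinate [j] drops, which is
   harmless for differences from [i]. *)
have [S [Sc SL Sv Sm [s0 Sr]]] := flows_vertex i (tray T j).
pose S1 := [set tmove (tpos (tray T j)) s [set j]%SET | s in `[0, t]].
have ij : (i \in [set j]%SET) = false by rewrite inE eq_sym (negbTE ji).
exists (S1 `|` S); split.
- apply: connectedU => //.
    exists (tpos (tray T j)); split=> //; exists 0; last by rewrite tmove0.
    by rewrite /= in_itv /= t0 lexx.
  by apply: connected_tmove; exact: interval_is_interval.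
- move=> y [[s]|/SL //]; rewrite /= in_itv /= => /andP[s0' _] <-.
  by right; exists j; exists s.
- by left; exists t => //=; rewrite in_itv /= t0 lexx.
- move=> y [[s]|Sy] /=; last first.
    move=> m; apply: le_trans (Sm y Sy m); rewrite dif_tmove ij.
    by case: (m \in _) => /=; lra.
  rewrite in_itv /= => /andP[_ st] <- m; rewrite !dif_tmove ij.
  by case: (m \in _) => /=; lra.
- by exists s0 => s /Sr; right.
Qed.

(** * Components of the complement of a point *)

Definition gains c i x : Prop := exists m, dif c i m < dif x i m.

(** The connected set leading from [x] to the leaf avoids [c], where the difference of [i] and [m]
    is smaller than at [x]. *)
Lemma leaf_in_component c i x : tsupport T x -> gains c i x ->
  leaf_in T i (connected_component (tsupport T `\ c) x).
Proof.
move=> Lx [m cx]; have [S [Sc SL Sx Sm [t0 Sr]]] := flows_support i Lx.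
exists t0 => t /Sr; apply: connected_component_max => // y Sy.
split; first exact: SL.
by move=> /= yc; have := Sm y Sy m; rewrite yc leNgt cx.
Qed.

Lemma leaf_in_meet i (C D : set (TP R n)) :
  leaf_in T i C -> leaf_in T i D -> C `&` D !=set0.
Proof.
move=> [s Cs] [t Dt]; exists (tmove (tpos (tray T i)) (Num.max s t) [set i]%SET).
by split; [apply: Cs | apply: Dt]; rewrite le_max lexx ?orbT.
Qed.

Lemma component_of_meet (A C D : set (TP R n)) :
  component_of A C -> component_of A D -> C `&` D !=set0 -> C = D.
Proof.
move=> [x Ax ->] [y Ay ->] [z [xz yz]].
rewrite (same_connected_component xz); symmetry.
exact: same_connected_component.
Qed.

Lemma gains_component c i x C : component_of (tsupport T `\ c) C ->
  leaf_in T i C -> tsupport T x -> gains c i x -> C x.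
Proof.
move=> Cc Ci Lx cx.
have xc : (tsupport T `\ c) x.
  split=> //= xc; case: cx => m; by rewrite xc ltxx.
have -> : C = connected_component (tsupport T `\ c) x.
  apply: component_of_meet Cc _ _; first by exists x.
  by apply: leaf_in_meet Ci _; exact: leaf_in_component.
exact: connected_component_refl.
Qed.

(** Distinct branches are not connected off [c]: the branch [I] cuts out a subset that is both open
    and closed in the component [K] of [x]. It contains [x], so by connectedness it would be all of
    [K], yet [y] is not in it. *)
Lemma branch_components c F i j I J x y :
  branching (tsupport T) c F -> F I -> F J -> I <> J ->
  i \in I -> j \in J -> tsupport T x -> tsupport T y ->
  strictly_raised I c x -> strictly_raised J c y ->
  connected_component (tsupport T `\ c) x <>
    connected_component (tsupport T `\ c) y.
Proof.
move=> [Fcov Fdis Fn0 Fmove Fsep] FI FJ IJ iI jJ Lx Ly cx cy xy.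
set K := connected_component _ x in xy.
have jI : j \notin I by apply/negP => jI; apply: IJ; exact: Fdis jI jJ.
have iJ : i \notin J by apply/negP => iJ; apply: IJ; exact: Fdis iI iJ.
have yc : (tsupport T `\ c) y.
  by split=> //= yc; have := cy.1 j i jJ iJ; rewrite yc ltxx.
have xc : (tsupport T `\ c) x.
  by split=> //= xc; have := cx.1 i j iI jI; rewrite xc ltxx.
have Kc : connected K := @component_connected _ _ _.
have Kx : K x by exact: connected_component_refl.
have Ky : K y by rewrite xy; exact: connected_component_refl.
(* The branch [I] is described twice: by the open condition that [i] gains over some coordinate, and
   by the closed condition that no label outside [I] gains over any. *)
pose U := \bigcup_m [set z | dif c i m < dif z i m].
pose V := \bigcap_(k in [set k : 'I_n | k \notin I]) \bigcap_m
  [set z | dif z k m <= dif c k m].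
have KUV : K `&` U = K `&` V.
  apply/seteqP; split=> z [Kz].
    move=> [m _ /= czm]; split=> // k /= kI l _ /=.
    have [Lz zc] := connected_component_sub Kz.
    have [I' [FI' [z1 z2]]] := Fsep z Lz zc.
    have iI' : i \in I'.
      apply: contraTT czm => iI'; rewrite -leNgt.
      have [mI'|mI'] := boolP (m \in I'); last by rewrite z2.
      by rewrite difC (difC c) lerN2 ltW // z1.
    have kI' : k \notin I'.
      by apply: contra kI => kI'; rewrite (Fdis _ _ i FI FI').
    have [lI'|lI'] := boolP (l \in I'); last by rewrite z2.
    by rewrite difC (difC c) lerN2 ltW // z1.
  move=> Vz; split=> //; exists j => //=.
  have [Lz zc] := connected_component_sub Kz.
  have [I' [FI' [z1 z2]]] := Fsep z Lz zc.
  have [II'|II'] := eqVneq I I'; first by rewrite z1 // -II'.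
  have /finset.set0Pn[k kI'] := Fn0 _ FI'.
  have kI : k \notin I.
    by apply: contra II' => kI; apply/eqP; exact: Fdis kI kI'.
  have iI' : i \notin I'.
    by apply: contra II' => iI'; apply/eqP; exact: Fdis iI iI'.
  by have := Vz k kI i Logic.I; rewrite /= leNgt (z1 k i).
have oU : open U.
  apply: bigcup_open => m _; apply: open_comp (@open_gt _ (dif c i m)).
  by move=> z _; exact: dif_continuous.
have cV : closed V.
  apply: closed_bigI => k _; apply: closed_bigI => m _.
  apply: closed_comp (@closed_le _ (dif c k m)).
  by move=> z _; exact: dif_continuous.
have KU : K `&` U = K.
  apply: Kc; first by exists x; split=> //; exists j => //; exact: cx.1.
    by exists U.
  by exists V.
have [_ [m _ /=]] : (K `&` U) y by rewrite KU.
have [mJ|mJ] := boolP (m \in J); last by rewrite cy.2 // ltxx.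
by rewrite difC (difC y) ltrN2 ltNge ltW // cy.1.
Qed.
End TropicalTree.

(** * Minimal terms along the pencil *)

Section FixedLocus.
Set Implicit Arguments.
Unset Strict Implicit.
Context {R : realType} {n : nat} {T : tree_data R n}.
Context (a : 'I_n -> 'rV[int]_3) (P : TP R 3).
Context (Tcomb : combinatorial_tree T) (Tdir : edge_directions T).
Context (Tinj : injective (@tpos _ _ T)).
Implicit Types (i j k m : 'I_n) (x y c : TP R n) (I J : {set 'I_n}).

Local Notation term := (trop_term a ^~ P).

Definition separated_min c : Prop :=
  (exists (i j k l : 'I_n) (C D : set (TP R n)),
     [/\ i != j, k != l,
         [/\ component_of (tsupport T `\ c) C,
             component_of (tsupport T `\ c) D & C <> D],
         [/\ leaf_in T i C, leaf_in T j C, leaf_in T k D & leaf_in T l D]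
       & [/\ attains_min a c P i, attains_min a c P j,
             attains_min a c P k & attains_min a c P l]])
  \/
  (exists (i j k : 'I_n) (C D E : set (TP R n)),
     [/\ [/\ component_of (tsupport T `\ c) C,
             component_of (tsupport T `\ c) D
           & component_of (tsupport T `\ c) E],
         [/\ C <> D, C <> E & D <> E],
         [/\ leaf_in T i C, leaf_in T j D & leaf_in T k E]
       & [/\ attains_min a c P i, attains_min a c P j
           & attains_min a c P k]]).

(** The contribution of [P] is the same at [x] and [y], so it cancels. *)
Lemma term_sub x y i m :
  term y i - term y m = term x i - term x m + (dif y i m - dif x i m).
Proof. by rewrite /trop_term /dif; lra. Qed.

(** If some difference from [i] were larger at [x] than at [c], then [x] would lie in [C] by
    [gains_component]. *)
Lemma attains_min_outside c x i C :
  component_of (tsupport T `\ c) C -> leaf_in T i C ->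
  attains_min a c P i -> tsupport T x -> ~ C x -> attains_min a x P i.
Proof.
move=> Cc Ci ci Lx Cx m; rewrite -subr_le0 (term_sub c).
have := ci m; rewrite -subr_le0.
suff : dif x i m <= dif c i m by lra.
rewrite leNgt; apply/negP => lt; apply: Cx.
by apply: (gains_component Tcomb Tdir Cc Ci Lx); exists m.
Qed.

(** At most one of the given components contains [x]; the indices from the others remain minimal
    there, and at least two are left. *)
Lemma separated_min_fixed c : tsupport T c -> separated_min c ->
  fixed_locus a (tsupport T) P.
Proof.
move=> Lc H x Lx.
have neq C D i j : component_of (tsupport T `\ c) C ->
    component_of (tsupport T `\ c) D -> C <> D ->
    leaf_in T i C -> leaf_in T j D -> i != j.
  move=> Cc Dc CD Ci Dj; apply/eqP => ij; apply: CD.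
  by apply: component_of_meet Cc Dc _; apply: leaf_in_meet Ci _; rewrite ij.
have out C D : component_of (tsupport T `\ c) C ->
    component_of (tsupport T `\ c) D -> C <> D -> C x -> ~ D x.
  by move=> Cc Dc CD Cx Dx; apply: CD; apply: component_of_meet Cc Dc _; exists x.
case: H => [[i [j [k [l [C [D [ij kl [Cc Dc CD] [Ci Cj Dk Dl]]]]]]]]|].
  move=> [ci cj ck cl]; case: (pselect (C x)) => [Cx|Cx].
    have Dx := out _ _ Cc Dc CD Cx.
    exists k, l; split=> //; first exact: attains_min_outside Dc Dk ck Lx Dx.
    exact: attains_min_outside Dc Dl cl Lx Dx.
  exists i, j; split=> //; first exact: attains_min_outside Cc Ci ci Lx Cx.
  exact: attains_min_outside Cc Cj cj Lx Cx.
move=> [i [j [k [C [D [E [[Cc Dc Ec] [CD CE DE] [Ci Dj Ek] [ci cj ck]]]]]]]].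
case: (pselect (C x)) => [Cx|Cx].
  have Dx := out _ _ Cc Dc CD Cx; have Ex := out _ _ Cc Ec CE Cx.
  exists j, k; split; first exact: neq Dc Ec DE Dj Ek.
    exact: attains_min_outside Dc Dj cj Lx Dx.
  exact: attains_min_outside Ec Ek ck Lx Ex.
case: (pselect (D x)) => [Dx|Dx].
  have Ex := out _ _ Dc Ec DE Dx.
  exists i, k; split; first exact: neq Cc Ec CE Ci Ek.
    exact: attains_min_outside Cc Ci ci Lx Cx.
  exact: attains_min_outside Ec Ek ck Lx Ex.
exists i, j; split; first exact: neq Cc Dc CD Ci Dj.
  exact: attains_min_outside Cc Ci ci Lx Cx.
exact: attains_min_outside Dc Dj cj Lx Dx.
Qed.

(** * From the fixed locus to separated minimal indices *)

Context (Pfix : fixed_locus a (tsupport T) P).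

(* Moving from [c] into the branch [J] raises exactly the terms in [J], so the
   two minimal terms at the new point both lie in [I]. *)
Lemma second_min_in_branch c F I J i :
  branching (tsupport T) c F -> F I -> F J -> I <> J -> i \in I ->
  attains_min a c P i ->
  (forall k, attains_min a c P k -> k \in I \/ k \in J) ->
  exists j, [/\ i != j, j \in I & attains_min a c P j].
Proof.
move=> [_ Fdis _ Fmove _] FI FJ IJ iI ci cIJ.
have iJ : i \notin J by apply/negP => iJ; apply: IJ; exact: Fdis iI iJ.
have [t [t0 Lx]] := Fmove J FJ; set x := tmove c t J in Lx.
have minx p : attains_min a x P p -> attains_min a c P p /\ p \in I.
  move=> xp; have := xp i; rewrite -subr_le0 (term_sub c) /x dif_tmove.
  rewrite (negbTE iJ) => le_pi; have le_ip := ci p.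
  have pJ : p \notin J by apply/negP => pJ; move: le_pi; rewrite pJ /=; lra.
  have cp : attains_min a c P p.
    by move=> m; move: le_pi (ci m); rewrite (negbTE pJ) /=; lra.
  by split=> //; case: (cIJ p cp) => //; rewrite (negbTE pJ).
have [p [q [pq /minx[cp pI] /minx[cq qI]]]] := Pfix Lx.
have [ip|ip] := eqVneq i p; last by exists p.
by exists q; split=> //; rewrite ip.
Qed.

Lemma separated_min_of_branching c F I J i j :
  branching (tsupport T) c F -> F I -> F J -> I <> J ->
  i \in I -> j \in J -> attains_min a c P i -> attains_min a c P j ->
  separated_min c.
Proof.
move=> B FI FJ IJ iI jJ ci cj; have [Fcov Fdis _ Fmove _] := B.
have point K : F K -> exists x, tsupport T x /\ strictly_raised K c x.
  move=> /Fmove[t [t0 Lx]]; exists (tmove c t K); split=> //.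
  exact: strictly_raised_tmove (raised_refl _ _).
pose comp x := connected_component (tsupport T `\ c) x.
have other K K' l : F K -> F K' -> K <> K' -> l \in K -> l \notin K'.
  by move=> FK FK' KK' lK; apply/negP => lK'; apply: KK'; exact: Fdis lK lK'.
have in_comp x K K' l m : F K -> F K' -> K <> K' -> tsupport T x ->
    strictly_raised K c x -> l \in K -> m \in K' ->
    component_of (tsupport T `\ c) (comp x) /\ leaf_in T l (comp x).
  move=> FK FK' KK' Lx cx lK mK'.
  have mK : m \notin K by apply: (other K') => //; exact: nesym.
  split.
    exists x => //; split=> //= xc.
    by have := cx.1 l m lK mK; rewrite xc ltxx.
  by apply: leaf_in_component => //; exists m; exact: cx.1.
have [x [Lx cx]] := point I FI; have [y [Ly cy]] := point J FJ.
have JI : J <> I by exact: nesym.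
have xy : comp x <> comp y by exact: branch_components B FI FJ IJ iI jJ _ _ cx cy.
have [Cx Cxi] := in_comp x I J i j FI FJ IJ Lx cx iI jJ.
have [Cy Cyj] := in_comp y J I j i FJ FI JI Ly cy jJ iI.
(* A minimal index outside [I] and [J] supplies a third component; otherwise [second_min_in_branch]
   applies to both branches. *)
case: (pselect (exists k, [/\ attains_min a c P k, k \notin I & k \notin J])).
  move=> [k [ck kI kJ]]; right; have [K [FK kK]] := Fcov k.
  have IK : I <> K by move=> e; move: kI; rewrite e kK.
  have JK : J <> K by move=> e; move: kJ; rewrite e kK.
  have [z [Lz cz]] := point K FK.
  have [Cz Czk] := in_comp z K I k i FK FI (nesym IK) Lz cz kK iI.
  exists i, j, k, (comp x), (comp y), (comp z); split=> //; split=> //.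
    exact: branch_components B FI FK IK iI kK _ _ cx cz.
  exact: branch_components B FJ FK JK jJ kK _ _ cy cz.
move=> no.
have cIJ k : attains_min a c P k -> k \in I \/ k \in J.
  move=> ck; apply: contrapT => /not_orP[/negP kI /negP kJ].
  by apply: no; exists k.
have [i' [ii' i'I ci']] := second_min_in_branch B FI FJ IJ iI ci cIJ.
have [j' [jj' j'J cj']] : exists j', [/\ j != j', j' \in J & attains_min a c P j'].
  apply: second_min_in_branch B FJ FI JI jJ cj _ => k /cIJ[]; by [right|left].
have [_ Cxi'] := in_comp x I J i' j FI FJ IJ Lx cx i'I jJ.
have [_ Cyj'] := in_comp y J I j' i FJ FI JI Ly cy j'J iI.
by left; exists i, i', j, j', (comp x), (comp y).
Qed.

(** At a vertex [v] of least excess the minimal indices either meet two branches, or all lie beyond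
    one edge [vw]. In the second case none of them is minimal at [w], so the minimum passes to the
    other side at an inner point of this edge. *)
Lemma separated_min_exists (i0 : 'I_n) :
  exists c, tsupport T c /\ separated_min c.
Proof.
pose least v := [arg min_(i < i0) term (tpos (v : tvertex T)) i]%O.
have leastP v : attains_min a (tpos v) P (least v).
  by move=> m; rewrite /least; case: arg_minP => // i _; apply.
pose excess v := \sum_m (term (tpos v) m - term (tpos v) (least v)).
have [v _ vmin] := @arg_minP _ R _ (tray T i0) xpredT excess isT.
have Lv : tsupport T (tpos v).
  (* A vertex lies in the support because a walk to a leaf starts there. *)
  have := flows_vertex Tcomb Tdir i0 v; case=> S [_ SL Sv _ _]; exact: SL.
have B := vertex_branching Tcomb Tdir Tinj v.
have [Fcov _ _ _ _] := B.
have [I [FI iI]] := Fcov (least v).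
case: (pselect (exists j, attains_min a (tpos v) P j /\ j \notin I)).
  move=> [j [cj jI]]; exists (tpos v); split=> //; have [J [FJ jJ]] := Fcov j.
  have IJ : I <> J by move=> e; move: jI; rewrite e jJ.
  exact: separated_min_of_branching B FI FJ IJ iI jJ (leastP v) cj.
move=> no.
have minI j : attains_min a (tpos v) P j -> j \in I.
  by move=> cj; apply: contrapT => /negP jI; apply: no; exists j.
case: FI => [[w [vw IE]]|[i [_ IE]]]; last first.
  (* A single ray cannot hold two distinct minimal indices. *)
  have [p [q [pq /minI + /minI]]] := Pfix Lv.
  by rewrite IE !inE => /eqP pi /eqP qi; rewrite pi qi eqxx in pq.
have [l0 _ wE] := Tdir vw; rewrite -IE in wE; set l := tlen v w in l0 wE.
have tw p q : term (tpos w) p - term (tpos w) q =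
    term (tpos v) p - term (tpos v) q + l * ((p \in I)%:R - (q \in I)%:R).
  by rewrite (term_sub (tpos v)) wE dif_tmove; lra.
(* Otherwise passing from [v] to [w] would decrease the excess. *)
have minw p : attains_min a (tpos w) P p -> p \notin I.
  move=> wp; apply/negP => pI; have := vmin w isT; apply/negP; rewrite -ltNge.
  have : tside v w != finset.setT by exact: tside_neqT.
  rewrite -IE -finset.subTset => /fintype.subsetPn[k _ kI].
  apply: (@le_lt_trans _ _ (\sum_m (term (tpos w) m - term (tpos w) p))).
    by apply: ler_sum => m _; have := wp (least w); lra.
  (* Relative to the term [p] in [I], passing to [w] lowers the terms outside [I] by [l] and keeps
     the others; [k] makes the inequality strict. *)
  apply: (@lt_le_trans _ _ (\sum_m (term (tpos v) m - term (tpos v) p))).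
    rewrite (bigD1 k) //= [ltRHS](bigD1 k) //=.
    apply: ltr_leD.
      by rewrite tw pI (negbTE kI) /=; lra.
    by apply: ler_sum => m _; rewrite tw pI; case: (m \in I) => /=; lra.
  by apply: ler_sum => m _; have := leastP v p; lra.
have jI := minw _ (leastP w).
have [vi wj] := (leastP v, leastP w).
set i := least v in iI vi; set j := least w in jI wj.
(* The gap at [v] between the terms [j] and [i]: after a move of length [s] into the edge they
   tie. *)
pose s := term (tpos v) j - term (tpos v) i.
have s0 : 0 < s.
  rewrite ltNge; apply/negP => s0; have /minI : attains_min a (tpos v) P j.
    by move=> m; have := vi m; rewrite /s in s0; lra.
  by rewrite (negbTE jI).
have sl : s < l.
  rewrite ltNge; apply/negP => ls; have /minw : attains_min a (tpos w) P i.
    move=> m; have := wj m; have := tw i j.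
    by rewrite iI (negbTE jI) /= /s in ls *; lra.
  by rewrite iI.
have s0l : 0 < s < tlen v w by rewrite s0.
have Bs := edge_branching Tcomb Tdir Tinj vw s0l.
set c := tmove _ _ _ in Bs.
have tc p q : term c p - term c q =
    term (tpos v) p - term (tpos v) q + s * ((p \in I)%:R - (q \in I)%:R).
  by rewrite (term_sub (tpos v)) /c dif_tmove -IE; lra.
have cij : term c i = term c j.
  by have := tc i j; rewrite iI (negbTE jI) /= /s; lra.
(* Inside [I] the order of the terms is that at [v], where [i] is minimal; outside [I] it is that at
   [w], where [j] is minimal. *)
have ci : attains_min a c P i.
  move=> m; have := tc i m; rewrite iI; have [mI|mI] := boolP (m \in I).
    by have := vi m; rewrite /=; lra.
  have := tw j m; have := wj m; rewrite (negbTE jI) (negbTE mI) /= /s; lra.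
have cj : attains_min a c P j by move=> m; rewrite -cij.
exists c; split.
  by left; exists v, w; split=> //; exists s => //=; rewrite !ltW.
have jI' : j \in tside w v by rewrite tsideC // finset.in_setC -IE.
rewrite IE in iI jI.
have IJ : tside v w <> tside w v by move=> e; move: jI; rewrite e jI'.
by apply: separated_min_of_branching Bs _ _ IJ iI jI' ci cj; [left|right].
Qed.

End FixedLocus.

Theorem theorem1p1 (R : realType) (n : nat) (d : int)
    (a : 'I_n -> 'rV[int]_3) (T : tree_data R n) (P : TP R 3)
    (hn : (3 <= n)%N)
    (ha_inj : injective a)
    (ha_ge0 : forall (m : 'I_n) (k : 'I_3), 0 <= a m 0 k)
    (ha_deg : forall m : 'I_n, \sum_k a m 0 k = d)
    (ha_dim : has_dim (conv_hull (fun m => map_mx intr (a m) : 'rV[R]_3)) 2)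
    (hL : tropical_line T) :
  fixed_locus a (tsupport T) P <->
  exists c : TP R n, tsupport T c /\
    ((exists (i j k l : 'I_n) (C D : set (TP R n)),
        [/\ i != j, k != l,
            [/\ component_of (tsupport T `\ c) C,
                component_of (tsupport T `\ c) D & C <> D],
            [/\ leaf_in T i C, leaf_in T j C, leaf_in T k D & leaf_in T l D]
          & [/\ attains_min a c P i, attains_min a c P j,
                attains_min a c P k & attains_min a c P l]])
     \/
     (exists (i j k : 'I_n) (C D E : set (TP R n)),
        [/\ [/\ component_of (tsupport T `\ c) C,
                component_of (tsupport T `\ c) D
              & component_of (tsupport T `\ c) E],
            [/\ C <> D, C <> E & D <> E],
            [/\ leaf_in T i C, leaf_in T j D & leaf_in T k E]
          & [/\ attains_min a c P i, attains_min a c P j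
              & attains_min a c P k]])).
Proof.
have [Tcomb _ Tdir [Tinj _ _ _] _] := hL; split.
  move=> Pfix; pose i0 := Ordinal (leq_trans (isT : (0 < 3)%N) hn).
  exact: (separated_min_exists Tcomb Tdir Tinj Pfix i0).
by move=> [c [Lc]]; exact: (separated_min_fixed Tcomb Tdir).
Qed.
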